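(* Let $C>0$ be a constant, and for each integer $n \ge C$, $n \ge 1$, let $G = G_n$ be the Erdős–Rényi random graph on the vertex set $\{1,2,\dots,n\}$ with edge probability $p = \frac{C}{n}$. For $M>0$, let $E(M)$ denote the event that there is a component of $G$ containing at least $\frac{n}{2}$ vertices and every other component of $G$ contains less than $M\log n$ vertices; and let $F(M)$ denote the event that every component of $G$ contains less than $M\log n$ vertices. (i) If $C > e^{3}$, there are positive constants $M_1$ and $\epsilon_1$ (independent of $n$) such that $\mathbb{P}(E(M_1)) \ge \epsilon_1$ for all $n$ sufficiently large. (ii) If $C < e^{-1}$, there is a positive constant $M_2$ (independent of $n$) such that $\mathbb{P}(F(M_2)) \ge 1 - \frac{1}{n^2}$ for all $n$ sufficiently large.
   Context: The Erdős–Rényi random graph on $\{1,\dots,n\}$ with edge probability $p$ is the random simple graph in which each of the $\binom{n}{2}$ possible edges $\{i,j\}$, $i\neq j$, is present (open) with probability $p$ and absent (closed) otherwise, independently of all other edges. A component of $G$ is a connected component of the graph formed by the open edges (an isolated vertex is a component with one vertex). $\log$ is the natural logarithm. All constants are independent of $n$; they may depend on $C$, as may the threshold in ''$n$ sufficiently large''. *)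

(* Defs.v *)
From HB Require Import structures.
From mathcomp Require Import all_boot all_order all_algebra.
From mathcomp Require Import all_classical all_reals all_analysis.

Set Implicit Arguments.
Unset Strict Implicit.
Unset Printing Implicit Defensive.

Import Order.TTheory GRing.Theory Num.Theory.
Local Open Scope ring_scope.

(* The vertex set {1, ..., n} is represented by 'I_n; an unordered pair
   {i, j} with i != j is a two-element subset of 'I_n. *)
Definition edge (n : nat) := {e : {set 'I_n} | #|e| == 2%N}.

(* A simple graph on n labelled vertices, given by which edges are open. *)
Definition config (n : nat) := {ffun edge n -> bool}.

Definition adj (n : nat) (w : config n) : rel 'I_n :=
  [rel x y | [exists e : edge n, w e && (val e == [set x; y])]].

(* connect is the reflexive transitive closure, so an isolated vertex x has
   component [set x]. *)
Definition component (n : nat) (w : config n) (x : 'I_n) : {set 'I_n} :=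
  [set y | connect (adj w) x y].

Definition components (n : nat) (w : config n) : {set {set 'I_n}} :=
  [set component w x | x : 'I_n].

(* The product of the Bernoulli(p) laws of the individual edges. *)
Definition er_weight (R : realType) (n : nat) (p : R) (w : config n) : R :=
  \prod_(e : edge n) (if w e then p else 1 - p).

Definition er_prob (R : realType) (n : nat) (p : R) (A : pred (config n)) : R :=
  \sum_(w : config n | A w) er_weight p w.

Definition event_E (R : realType) (n : nat) (M : R) : pred (config n) :=
  [pred w | [exists S in components w,
     (n%:R / 2 <= #|S|%:R :> R) &&
     [forall T in components w, (T != S) ==> (#|T|%:R < M * ln (n%:R : R))]]].

Definition event_F (R : realType) (n : nat) (M : R) : pred (config n) :=
  [pred w | [forall T in components w, #|T|%:R < M * ln (n%:R : R)]].

(* The next lemmas check that er_prob is the law under which the edges are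
   independently open with probability p (it is nonnegative for 0 <= p <= 1). *)
Lemma er_prob_ge0 (R : realType) (n : nat) (p : R) (A : pred (config n)) :
  0 <= p <= 1 -> 0 <= er_prob p A.
Proof.
case/andP=> p0 p1; apply: sumr_ge0 => w _; apply: prodr_ge0 => e _.
by case: (w e); rewrite ?subr_ge0.
Qed.

Lemma er_prob_pattern (R : realType) (n : nat) (p : R)
    (B : {set edge n}) (f : edge n -> bool) :
  er_prob p [pred w : config n | [forall e in B, w e == f e]] =
  \prod_(e in B) (if f e then p else 1 - p).
Proof.
pose Q (e : edge n) : pred bool := [pred b | (e \in B) ==> (b == f e)].
transitivity (\prod_(e : edge n) \sum_(b | Q e b) (if b then p else 1 - p)).
  by rewrite bigA_distr_big_dep; apply: eq_bigl => w /=; apply/forallP/familyP.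
rewrite [RHS]big_mkcond; apply: eq_bigr => e _.
rewrite big_mkcond big_bool /Q /=.
by case: (e \in B); case: (f e); rewrite /= ?addr0 ?add0r // addrC subrK.
Qed.

Lemma er_prob_total (R : realType) (n : nat) (p : R) :
  er_prob p [pred w : config n | true] = 1.
Proof.
transitivity (er_prob p [pred w : config n | [forall e in finset.set0, w e == true]]).
  by apply: eq_bigl => w /=; apply/esym/forallP => e; rewrite finset.in_set0.
by rewrite er_prob_pattern big_set0.
Qed.

Lemma er_prob_edge (R : realType) (n : nat) (p : R) (e : edge n) :
  er_prob p [pred w : config n | w e] = p.
Proof.
transitivity (er_prob p [pred w : config n |
    [forall e' in finset.set1 e, w e' == true]]).
  apply: eq_bigl => w /=; apply/idP/forallP => [we e'|/(_ e)].
    by rewrite finset.in_set1; apply/implyP => /eqP->; rewrite we.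
  by rewrite finset.in_set1 eqxx /= => /eqP.
by rewrite er_prob_pattern big_set1.
Qed.

Lemma er_prob_indep (R : realType) (n : nat) (p : R) (B : {set edge n}) :
  er_prob p [pred w : config n | [forall e in B, w e]] =
  \prod_(e in B) er_prob p [pred w : config n | w e].
Proof.
under [RHS]eq_bigr => e _ do rewrite er_prob_edge.
rewrite -(er_prob_pattern p B xpredT); apply: eq_bigl => w /=.
by apply: eq_forallb => e; rewrite eqb_id.
Qed.

(* Main.v *)
Require Import Defs.
From mathcomp Require Import all_boot all_order all_algebra.
From mathcomp Require Import all_classical all_reals all_analysis.
From mathcomp Require Import ring lra zify.
Import Order.TTheory GRing.Theory Num.Theory.
Local Open Scope ring_scope.

Set Implicit Arguments.
Unset Strict Implicit.
Unset Printing Implicit Defensive.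

(* First moment method.  Orienting a spanning tree of a component S towards a
   vertex x gives a map f : S -> S such that the edges {v, f v}, v <> x, are
   #|S| - 1 distinct open edges; there are only k ^ k such maps when #|S| = k,
   and no edge leaving S is open.  Hence the expected number of components of
   size k is at most
     'C(n, k) k^k p^(k-1) (1-p)^(k(n-k)) <= (n/C) (e C)^k exp(- C k (n-k) / n).
   For C < 1/e this is (n/C) q^k with q = e C < 1; for C > e^3 and k <= n/2 it
   is at most (n/C) q^k with q = C e^(1 - C/2) < 1.  Both are summably small
   for k >= M log n.  In the second case, if moreover all components had at
   most n/2 vertices, some union of components would have between n/4 and 3n/4
   vertices, and the expected number of such unions is at most
   2^n exp(- 3 C n / 16). *)

(** * Shortest paths and parent maps *)

Lemma connect_parent (T : finType) (e : rel T) (x : T) :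
  exists (d : T -> nat) (f : T -> T), forall v, connect e x v -> v != x ->
    [/\ connect e x (f v), e (f v) v & (d (f v) < d v)%N].
Proof.
pose P v m := [exists t : m.-tuple T, path e x t && (last x t == v)].
have PP v (p : seq T) : path e x p -> last x p = v -> P v (size p).
  by move=> ep lp; apply/existsP; exists (in_tuple p); rewrite /= ep lp eqxx.
(* [d v] is the length of a shortest path from [x] to [v], and 0 by default when [v] cannot be
   reached. *)
have /choice[d dP] v : exists m, connect e x v ->
    P v m /\ forall m', P v m' -> (m <= m')%N.
  have [cv|] := boolP (connect e x v); last by exists 0%N.
  have exP : exists m, P v m.
    by case/connectP: cv => p ep lp; exists (size p); exact: PP.
  by exists (ex_minn exP) => _; case: ex_minnP.
exists d; suff /choice[f fP] v : exists u, connect e x v -> v != x ->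
    [/\ connect e x u, e u v & (d u < d v)%N] by exists f.
have [cv|] := boolP (connect e x v); last by exists x.
have [->|vx] := eqVneq v x; first by exists x.
have [/existsP[t /andP[et /eqP lt]] _] := dP v cv.
have st : size t = d v by rewrite size_tuple.
(* The parent of [v] is the penultimate vertex of a shortest path; deleting the last step shows that
   it is strictly closer to [x]. *)
case/lastP: (val t) et lt st => [_ /= xv|p u]; first by rewrite xv eqxx in vx.
rewrite rcons_path last_rcons size_rcons => /andP[ep eu] uv sp.
exists (last x p) => _ _; have cl : connect e x (last x p) by apply/connectP; exists p.
by split; rewrite -?uv // uv -sp ltnS; apply: (dP _ cl).2; exact: PP.
Qed.

(** * Union bounds and complements for the edge law *)

Section Law.
Variables (R : realType) (n : nat) (p : R).
Hypothesis p01 : 0 <= p <= 1.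

Lemma er_weight_ge0 (w : config n) : 0 <= er_weight p w.
Proof.
case/andP: p01 => p0 p1; apply: prodr_ge0 => e _.
by case: (w e); rewrite ?subr_ge0.
Qed.

Lemma er_prob_union (I : finType) (P : pred I) (A : I -> pred (config n))
    (D : pred (config n)) :
  (forall w, D w -> exists2 i, P i & A i w) ->
  er_prob p D <= \sum_(i | P i) er_prob p (A i).
Proof.
move=> DA; rewrite /er_prob.
under [leRHS]eq_bigr => i _ do rewrite big_mkcond.
rewrite exchange_big /= big_mkcond; apply: ler_sum => w _.
have sum_ge0 (Q : pred I) : 0 <= \sum_(i | Q i) (if A i w then er_weight p w else 0).
  by apply: sumr_ge0 => i _; case: ifP => // _; exact: er_weight_ge0.
case: ifP => // /DA[i Pi Ai]; rewrite (bigD1 i) //= Ai lerDl.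
exact: sum_ge0.
Qed.

Lemma er_prob_le (A B : pred (config n)) :
  (forall w, A w -> B w) -> er_prob p A <= er_prob p B.
Proof.
move=> AB; have := @er_prob_union unit xpredT (fun=> B) A.
by rewrite big_const card_unit /= addr0; apply=> w /AB; exists tt.
Qed.

Lemma er_prob_predU (A B D : pred (config n)) :
  (forall w, D w -> A w || B w) -> er_prob p D <= er_prob p A + er_prob p B.
Proof.
move=> DAB; have := @er_prob_union _ xpredT (fun b => if b then A else B) D.
rewrite big_bool /=; apply=> w /DAB/orP[]; by [exists true|exists false].
Qed.

Lemma er_prob_predC (A : pred (config n)) :
  er_prob p A = 1 - er_prob p (predC A).
Proof.
by rewrite -(er_prob_total n p) [in RHS]/er_prob (bigID A xpredT) /= addrK.
Qed.

End Law.

(** * Cut edges and detached sets *)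

Section Graph.
Variables (n : nat).
Implicit Types (w : config n) (S : {set 'I_n}) (x y : 'I_n).

Lemma adj_sym w : symmetric (adj w).
Proof. by move=> x y; apply: eq_existsb => e; rewrite finset.setUC. Qed.

Lemma adj_connect_sym w : connect_sym (adj w).
Proof. exact: sym_connect_sym (adj_sym w). Qed.

Lemma mem_components w S x :
  S \in components w -> x \in S -> S = component w x.
Proof.
case/imsetP => y _ ->; rewrite finset.inE => yx; apply/setP => z.
rewrite !finset.inE; exact: same_connect (adj_connect_sym w) _ _ yx z.
Qed.

(** Cut edges and parent edges are both given as images of a parametrization, so counting them
    reduces to its injectivity. *)
Lemma card_edge_imset (T : finType) (D : {set T}) (g : T -> {set 'I_n}) :
  {in D &, injective g} -> (forall t, t \in D -> #|g t| == 2%N) ->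
  #|[set e : edge n | val e \in g @: D]| = #|D|.
Proof.
move=> gI g2; rewrite -(card_in_imset gI) -(card_imset _ val_inj).
apply: eq_card => A; apply/imsetP/idP => [[e]|]; first by rewrite finset.inE => ? ->.
case/imsetP => t tD ->; exists (exist _ (g t) (g2 t tD)) => //.
by rewrite finset.inE /= imset_f.
Qed.

Definition cut_edges S : {set edge n} :=
  [set e | val e \in [set [set xy.1; xy.2] | xy in finset.setX S (~: S)]].

Lemma card_cut_edges S : #|cut_edges S| = (#|S| * (n - #|S|))%N.
Proof.
rewrite card_edge_imset; first by rewrite cardsX [#|~: S|]cardsCs finset.setCK card_ord.
- move=> [a b] [c d]; rewrite !finset.inE /= => /andP[aS bS] /andP[cS dS] /setP E.
  have := E a; rewrite !finset.inE eqxx /= => /esym/orP[]/eqP ac; last first.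
    by rewrite -ac aS in dS.
  have := E b; rewrite !finset.inE eqxx orbT => /esym/orP[]/eqP bd.
    by rewrite bd cS in bS.
  by rewrite ac bd.
- move=> [a b]; rewrite !finset.inE /= => /andP[aS bS].
  by rewrite cards2 eqSS eqb1; apply: contraNneq bS => <-.
Qed.

(** The detached sets are exactly the unions of components. Phrasing this through closed cut edges
    makes it a pattern event, whose probability is a product. *)
Definition detached w S := [forall e in cut_edges S, ~~ w e].

Lemma detachedP w S :
  reflect (forall x y, x \in S -> adj w x y -> y \in S) (detached w S).
Proof.
apply: (iffP forall_inP) => [iS x y xS /existsP[e /andP[we /eqP eE]]|cS e].
  apply: contraLR we => yS; apply: iS; rewrite finset.inE eE.
  by apply/imsetP; exists (x, y); rewrite // !finset.inE xS.
rewrite finset.inE => /imsetP[[x y]]; rewrite !finset.inE /= => /andP[xS yS] eE.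
apply: contra yS => we; apply: (cS x) => //.
by apply/existsP; exists e; rewrite we; exact/eqP.
Qed.

Lemma detached_component w x : detached w (component w x).
Proof.
apply/detachedP => a b; rewrite !finset.inE => xa ab.
exact: connect_trans xa (connect1 ab).
Qed.

Lemma detached_setD_component w S x :
  detached w S -> detached w (S :\: component w x).
Proof.
move/detachedP => iS; apply/detachedP => a b; rewrite !finset.inE.
move=> /andP[xa aS] ab; rewrite (iS a b) // andbT.
apply: contra xa => xb; apply: connect_trans xb _.
by rewrite adj_connect_sym connect1.
Qed.

(* A smallest detached set with at least n/4 vertices drops below n/4 when one
   of its components, of size at most n/2, is removed. *)
Lemma exists_balanced_detached w : (0 < n)%N ->
  (forall x, 2 * #|component w x| <= n)%N ->
  exists2 S, detached w S & (n <= 4 * #|S| <= 3 * n)%N.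
Proof.
move=> n0 small; pose P S := detached w S && (n <= 4 * #|S|)%N.
have PT : P finset.setT.
  rewrite /P cardsT card_ord leq_pmull // andbT; apply/detachedP => x y _ _.
  by rewrite finset.inE.
case: (arg_minnP (fun S : {set 'I_n} => #|S|) PT) => S /andP[iS nS] minS.
exists S => //; rewrite nS /=.
have /card_gt0P[x xS] : (0 < #|S|)%N by lia.
have cSx := cardsID (component w x) S.
have cI : (#|S :&: component w x| <= #|component w x|)%N.
  exact/subset_leq_card/finset.subsetIr.
have cI0 : (0 < #|S :&: component w x|)%N.
  by apply/card_gt0P; exists x; rewrite !finset.inE xS connect0.
have sx := small x.
have sD : (4 * #|S :\: component w x| < n)%N.
  rewrite ltnNge; apply/negP => big; have := minS (S :\: component w x).
  rewrite /P detached_setD_component // big => /(_ isT).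
  by rewrite leqNgt -cSx -[X in (X < _)%N]add0n ltn_add2r cI0.
have arith i c d m : (i <= c -> 2 * c <= m -> 4 * d < m ->
  4 * (i + d) <= 3 * m)%N by lia.
by rewrite -cSx; exact: arith cI sx sD.
Qed.

(** * Spanning trees encoded by parent maps *)

Definition parent_edges S x (f : 'I_n -> 'I_n) : {set edge n} :=
  [set e | val e \in [set [set v; f v] | v in S :\ x]].

Lemma component_parent w S x : S = component w x ->
  exists f : {ffun 'I_n -> 'I_n},
  [/\ f \in pffun_on x (mem S) (mem S), #|parent_edges S x f| = #|S|.-1
    & forall e, e \in parent_edges S x f -> w e].
Proof.
move=> SE; have [d [f0 f0P]] := connect_parent (adj w) x.
have xS : x \in S by rewrite SE finset.inE connect0.
(* The root and all vertices outside [S] get the default value [x], so that [f] lies in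
   [pffun_on x], a family with only [#|S| ^ #|S|] members. *)
pose f := [ffun v => if v \in S :\ x then f0 v else x].
have fP v : v \in S :\ x -> [/\ f v \in S, adj w (f v) v & (d (f v) < d v)%N].
  move=> vS; rewrite /f ffunE vS; move: vS; rewrite !SE !finset.inE => /andP[vx xv].
  by have [] := f0P v xv vx.
exists f; split.
- apply/pffun_onP; split.
    apply/fintype.subsetP => v; rewrite finset.inE /= /f ffunE.
    by case: ifP => [|_]; rewrite ?eqxx // !finset.inE => /andP[].
  move=> _ /fintype.imageP[v vS ->]; rewrite /f ffunE.
  case: ifP => [vS'|_ //]; have [] := fP v vS'.
  by rewrite /f ffunE vS'.
- rewrite card_edge_imset; first by rewrite (cardsD1 x S) xS.
    (* If distinct [u] and [v] gave the same edge, each would be the parent of the other, and [d]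
       would decrease strictly both ways. *)
    move=> u v uS vS /setP E.
    have [_ _ du] := fP u uS; have [_ _ dv] := fP v vS.
    have := E u; rewrite !finset.inE eqxx /= => /esym/orP[]/eqP // uE.
    have := E v; rewrite !finset.inE eqxx /= => /orP[]/eqP // vE.
    by move: du dv; rewrite -vE -uE => /ltn_trans h /h; rewrite ltnn.
  move=> v vS; have [_ _ dv] := fP v vS; rewrite cards2 eqSS eqb1.
  by apply: contraTneq dv => <-; rewrite ltnn.
- move=> e; rewrite finset.inE => /imsetP[v vS eE].
  have [_ /existsP[e' /andP[we' /eqP e'E]] _] := fP v vS.
  suff -> : e = e' by [].
  by apply: val_inj; rewrite /= in eE *; rewrite eE e'E finset.setUC.
Qed.

(** A parent edge has both ends in [S]. Hence the tree and the cut use disjoint edges, and their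
    probabilities multiply. *)
Lemma parent_edges_cut S x (f : {ffun 'I_n -> 'I_n}) e :
  f \in pffun_on x (mem S) (mem S) ->
  e \in parent_edges S x f -> e \notin cut_edges S.
Proof.
move=> /pffun_onP[_ fS]; rewrite !finset.inE => /imsetP[v].
rewrite !finset.inE => /andP[_ vS] ->; apply/imsetP => -[[a b]].
rewrite !finset.inE /= => /andP[_ bS] /setP/(_ b); rewrite !finset.inE eqxx orbT.
by case/orP=> /eqP bE; move: bS; rewrite bE ?vS // fS // fintype.image_f.
Qed.

End Graph.

(** * Probability that a given set is detached or is a component *)

Section Probability.
Variables (R : realType) (n : nat) (p : R).
Hypothesis p01 : 0 <= p <= 1.
Implicit Types (S : {set 'I_n}).

Lemma er_prob_detached S :
  er_prob p [pred w : config n | detached w S] = (1 - p) ^+ (#|S| * (n - #|S|)).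
Proof.
transitivity (er_prob p [pred w : config n | [forall e in cut_edges S, w e == false]]).
  by apply: eq_bigl => w; apply: eq_forallb => e; rewrite eqbF_neg.
by rewrite (er_prob_pattern p (cut_edges S) xpred0) prodr_const card_cut_edges.
Qed.

Lemma er_prob_component_le S : (0 < #|S|)%N ->
  er_prob p [pred w : config n | S \in components w] <=
    (#|S| ^ #|S|)%:R * p ^+ #|S|.-1 * (1 - p) ^+ (#|S| * (n - #|S|)).
Proof.
move=> /card_gt0P[x xS].
(* The cardinality condition keeps only maps with [#|S|.-1] distinct edges, so all patterns in the
   union bound have the same probability. It is dropped when the maps are counted. *)
pose P (f : {ffun 'I_n -> 'I_n}) :=
  (f \in pffun_on x (mem S) (mem S)) && (#|parent_edges S x f| == #|S|.-1).
pose B f := parent_edges S x f :|: cut_edges S.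
pose A (f : {ffun 'I_n -> 'I_n}) : pred (config n) :=
  [pred w : config n | [forall e in B f, w e == (e \in parent_edges S x f)]].
have DA (w : config n) : [pred w : config n | S \in components w] w ->
    exists2 f, P f & A f w.
  move=> /= Sw; have SE := mem_components Sw xS.
  have [f [fS cf wf]] := component_parent SE; exists f.
    by rewrite /P fS cf eqxx.
  apply/forall_inP => e; rewrite finset.in_setU.
  have [ef _|_ /=] := boolP (e \in parent_edges S x f); first by rewrite wf.
  rewrite SE => ec; rewrite eqbF_neg; exact: (forall_inP (detached_component w x)).
apply: le_trans (er_prob_union p01 DA) _.
rewrite (eq_bigr (fun=> p ^+ #|S|.-1 * (1 - p) ^+ (#|S| * (n - #|S|)))).
  rewrite sumr_const -[leLHS]mulr_natl -mulrA ler_wpM2r //.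
    by case/andP: p01 => p0 p1; rewrite mulr_ge0 // exprn_ge0 // subr_ge0.
  rewrite ler_nat -(card_pffun_on x (mem S) (mem S)).
  by apply: subset_leq_card; apply/fintype.subsetP => f /andP[].
move=> f /andP[fS /eqP cf]; rewrite /A er_prob_pattern.
rewrite (eq_bigl (mem [predU parent_edges S x f & cut_edges S])); last first.
  by move=> e; rewrite finset.in_setU.
rewrite bigU /=; last first.
  rewrite disjoint_subset; apply/fintype.subsetP => e.
  exact: parent_edges_cut fS.
congr (_ * _).
  by rewrite -cf -prodr_const; apply: eq_bigr => e ->.
rewrite -card_cut_edges -prodr_const; apply: eq_bigr => e ec.
by case: ifP => // /(parent_edges_cut fS); rewrite ec.
Qed.

End Probability.

(** * Elementary numerical estimates *)

Lemma expn_le_expR_fact (R : realType) (k : nat) :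
  (k ^ k)%:R <= expR 1 ^+ k * k`!%:R :> R.
Proof.
case: k => [|k]; first by rewrite expr0 mul1r.
rewrite -ler_pdivrMr ?ltr0n ?fact_gt0 // -expRM_natl mulr1 natrX.
(* The quotient is a single term of the exponential series at [k.+1]. *)
by apply: le_trans (expR_ge1Dxn k (ler0n _ _)); rewrite lerDr ler01.
Qed.

Lemma bin_mul_fact_le (n k : nat) : ('C(n, k) * k`! <= n ^ k)%N.
Proof.
rewrite bin_ffact; elim: k n => [|k IH] [|n] //.
rewrite ffactnS expnS /= leq_mul2l /=; apply: leq_trans (IH n) _.
by case: k {IH} => // k; rewrite leq_exp2r.
Qed.

Lemma exp_one_sub_le (R : realType) (p : R) (m : nat) :
  p <= 1 -> (1 - p) ^+ m <= expR (- (p * m%:R)).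
Proof.
move=> p1; rewrite -mulNr mulrC expRM_natl lerXn2r ?nnegrE ?expR_ge0 ?subr_ge0 //.
exact: expR_ge1Dx.
Qed.

(** * First moment bounds at edge probability [C / n] *)

Section Sparse.
Variables (R : realType) (n : nat) (C : R).
Hypotheses (n_gt0 : (0 < n)%N) (C_gt0 : 0 < C) (C_le : C <= n%:R).

Let nR_gt0 : 0 < n%:R :> R. Proof. by rewrite ltr0n. Qed.

Lemma sparse_prob01 : 0 <= C / n%:R <= 1.
Proof. by rewrite divr_ge0 ?(ltW C_gt0) ?ler0n //= ler_pdivrMr // mul1r. Qed.

Lemma er_prob_component_size k : (0 < k <= n)%N ->
  er_prob (C / n%:R) [pred w : config n | [exists S in components w, #|S| == k]] <=
    n%:R / C * ((expR 1 * C) ^+ k * expR (- (C / n%:R * (k * (n - k))%:R))).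
Proof.
move=> /andP[k0 kn]; have p01 := sparse_prob01.
have [p0 p1] := andP p01.
have DA (w : config n) :
    [pred w : config n | [exists S in components w, #|S| == k]] w ->
    exists2 S : {set 'I_n}, #|S| == k & [pred w | S \in components w] w.
  by case/exists_inP => S; exists S.
apply: le_trans (er_prob_union p01 DA) _.
set b : R := (k ^ k)%:R * (C / n%:R) ^+ k.-1 * (1 - C / n%:R) ^+ (k * (n - k)).
apply: (@le_trans _ _ (\sum_(S : {set 'I_n} | #|S| == k) b)).
  apply: ler_sum => S /eqP Sk; rewrite /b -Sk.
  by apply: er_prob_component_le; rewrite ?Sk.
rewrite sumr_const -cardsE card_draws card_ord -[leLHS]mulr_natl /b.
rewrite [leRHS]mulrA [leLHS]mulrA ler_pM ?mulr_ge0 ?exprn_ge0 ?subr_ge0 ?ler0n //.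
  (* A tree on [k] vertices has only [k - 1] edges; the missing factor [p] is the source of
     [n / C]. *)
  have -> : n%:R / C * (expR 1 * C) ^+ k = n%:R ^+ k * expR 1 ^+ k * (C / n%:R) ^+ k.-1.
    case: k k0 {kn DA b} => // k _ /=.
    rewrite !exprMn exprVn !exprS; field.
    by rewrite !lt0r_neq0 ?exprn_gt0.
  rewrite mulrA ler_wpM2r ?exprn_ge0 //.
  (* Multiplying by [k!] splits the claim into ['C(n, k) * k! <= n ^ k] and
     [k ^ k <= e ^ k * k!]. *)
  rewrite -(ler_pM2r (_ : 0 < k`!%:R)) ?ltr0n ?fact_gt0 //.
  rewrite [leLHS]mulrAC -[leRHS]mulrA -natrM.
  by rewrite ler_pM ?ler0n ?expn_le_expR_fact // -natrX ler_nat bin_mul_fact_le.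
exact: exp_one_sub_le.
Qed.

(** Since [M * ln q = - 5], a size [k >= M * ln n] has [q ^ k <= n ^ (-5)]. At most [n] sizes occur,
    each costing [(n / C) * n ^ (-5)]. The predicate [Q] describes the bad sizes, which differ
    between the two regimes. *)
Lemma er_prob_component_sizes (M q : R) (Q : pred nat) : 0 < q < 1 ->
  M * ln q = - 5 ->
  (forall k, Q k -> M * ln n%:R <= k%:R) ->
  (forall k, Q k -> (0 < k <= n)%N ->
    (expR 1 * C) ^+ k * expR (- (C / n%:R * (k * (n - k))%:R)) <= q ^+ k) ->
  er_prob (C / n%:R) [pred w : config n | [exists S in components w, Q #|S|]] <=
    (C * n%:R ^+ 3)^-1.
Proof.
move=> /andP[q0 q1] Mq QM Qq; have p01 := sparse_prob01.
have DA (w : config n) :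
    [pred w : config n | [exists S in components w, Q #|S|]] w ->
    exists2 k : 'I_n.+1, Q k && (0 < k)%N &
      [pred w : config n | [exists S in components w, #|S| == k]] w.
  case/exists_inP => S Sw QS.
  have Sn : (#|S| < n.+1)%N by rewrite ltnS -[X in (_ <= X)%N]card_ord max_card.
  exists (Ordinal Sn); rewrite /= ?QS.
    by case/imsetP: Sw => x _ ->; apply/card_gt0P; exists x; rewrite finset.inE connect0.
  by apply/exists_inP; exists S.
apply: le_trans (er_prob_union p01 DA) _.
apply: (@le_trans _ _ (\sum_(k < n.+1 | Q k && (0 < k)%N) (n%:R / C * n%:R ^- 5))).
  apply: ler_sum => k /andP[Qk k0].
  have k0n : (0 < k <= n)%N by rewrite k0 -ltnS /=.
  apply: le_trans (er_prob_component_size k0n) _.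
  rewrite ler_wpM2l ?divr_ge0 ?ler0n ?(ltW C_gt0) //.
  apply: le_trans (Qq _ Qk k0n) _.
  have lnq : ln q < 0 by rewrite ln_lt0 ?q0.
  rewrite -{1}(lnK q0) -expRM_natl -[n%:R in leRHS](lnK nR_gt0) -expRM_natl -expRN.
  rewrite ler_expR; apply: (@le_trans _ _ (M * ln n%:R * ln q)).
    by rewrite ler_wnM2r ?(ltW lnq) ?QM.
  by rewrite mulrAC Mq mulNr.
rewrite sumr_const -[leLHS]mulr_natl.
apply: (@le_trans _ _ (n%:R * (n%:R / C * n%:R ^- 5))).
  rewrite ler_wpM2r ?mulr_ge0 ?invr_ge0 ?exprn_ge0 ?ler0n ?(ltW C_gt0) //.
  rewrite ler_nat; apply: (@leq_trans #|[pred k : 'I_n.+1 | k != ord0]|).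
    apply: subset_leq_card; apply/fintype.subsetP => k /andP[_].
    by rewrite lt0n.
  by rewrite cardC1 card_ord.
by rewrite le_eqVlt; apply/predU1P; left; field; rewrite !lt0r_neq0.
Qed.

(** For [s = #|S|] between [n/4] and [3n/4], [s * (n - s) >= 3 n^2 / 16]. With [C >= 8] each set
    thus has probability at most [exp (- 3 n / 2) <= (2 / 5) ^ n], and there are at most [2 ^ n]
    sets. *)
Lemma er_prob_balanced_detached : 8 <= C ->
  er_prob (C / n%:R) [pred w : config n |
    [exists S : {set 'I_n}, detached w S && (n <= 4 * #|S| <= 3 * n)%N]] <=
    (4 / 5) ^+ n.
Proof.
move=> C8; have p01 := sparse_prob01; have [p0 p1] := andP p01.
have DA (w : config n) : [pred w : config n |
    [exists S : {set 'I_n}, detached w S && (n <= 4 * #|S| <= 3 * n)%N]] w ->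
    exists2 S : {set 'I_n}, (n <= 4 * #|S| <= 3 * n)%N & [pred w | detached w S] w.
  by case/existsP => S /andP[]; exists S.
apply: le_trans (er_prob_union p01 DA) _.
have e32 : 5 / 2 <= expR (3 / 2) :> R by apply: le_trans (expR_ge1Dx _); lra.
apply: (@le_trans _ _ (\sum_(S : {set 'I_n} | (n <= 4 * #|S| <= 3 * n)%N)
    (2 / 5) ^+ n)).
  apply: ler_sum => S Sn; rewrite er_prob_detached.
  apply: le_trans (exp_one_sub_le _ p1) _.
  have cut : 3 * n%:R ^+ 2 <= 16 * (#|S| * (n - #|S|))%:R :> R.
    rewrite -natrX -!natrM ler_nat.
    have arith s m : (m <= 4 * s <= 3 * m -> 3 * m ^ 2 <= 16 * (s * (m - s)))%N by nia.
    exact: arith.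
  apply: (@le_trans _ _ (expR (- (n%:R * (3 / 2))))).
    rewrite ler_expR lerN2 mulrAC ler_pdivlMr // -(ler_pM2l (_ : 0 < 16)) //.
    apply: (@le_trans _ _ (C * (3 * n%:R ^+ 2))); first by nra.
    by rewrite [leRHS]mulrCA ler_pM2l.
  rewrite expRN expRM_natl -exprVn lerXn2r ?nnegrE ?invr_ge0 ?expR_ge0 //.
  by rewrite -[leRHS]invrK lef_pV2 ?posrE ?expR_gt0 // invf_div.
rewrite sumr_const -[leLHS]mulr_natl (_ : (4 / 5) ^+ n = 2 ^+ n * (2 / 5) ^+ n); last first.
  by rewrite -exprMn; congr (_ ^+ _); field.
rewrite ler_wpM2r ?exprn_ge0 ?divr_ge0 // -natrX ler_nat.
apply: leq_trans (max_card _) _.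
by rewrite -cardsT -powersetT card_powerset cardsT card_ord.
Qed.

End Sparse.

(** * Deterministic criterion for the giant component, and its decay rate *)

Lemma card_components_disjoint (n : nat) (w : config n) (S T : {set 'I_n}) :
  S \in components w -> T \in components w -> T != S -> (#|T| + #|S| <= n)%N.
Proof.
move=> Sw Tw TS; rewrite -[X in (_ <= X)%N](card_ord n) -(cardsC S) addnC leq_add2l.
apply: subset_leq_card; apply/fintype.subsetP => z zT; rewrite finset.inE.
apply: contra TS => zS.
by rewrite (mem_components Sw zS) (mem_components Tw zT).
Qed.

(** Without a balanced detached set some component exceeds [n/2]. Any other component is disjoint
    from it, hence below [n/2], and there the first hypothesis forces fewer than [M * ln n]
    vertices. *)
Lemma event_E_intro (R : realType) (n : nat) (M : R) (w : config n) : (0 < n)%N ->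
  ~~ [exists S in components w, (M * ln n%:R <= #|S|%:R) && (2 * #|S| <= n)%N] ->
  ~~ [exists S : {set 'I_n}, detached w S && (n <= 4 * #|S| <= 3 * n)%N] ->
  event_E M w.
Proof.
move=> n0 mid bal.
have [x xbig] : exists x, (n < 2 * #|component w x|)%N.
  apply: contrapT => nobig; case/negP: bal.
  have [|S dS cS] := exists_balanced_detached (w := w) n0.
    by move=> x; rewrite leqNgt; apply/negP => xbig; apply: nobig; exists x.
  by apply/existsP; exists S; rewrite dS.
have xw : component w x \in components w by exact: imset_f.
apply/exists_inP; exists (component w x) => //; apply/andP; split.
  by rewrite ler_pdivrMr // -natrM ler_nat mulnC ltnW.
apply/forall_inP => T Tw; apply/implyP => TS.
have TSn := card_components_disjoint xw Tw TS.
rewrite ltNge; apply: contra mid => MT; apply/exists_inP; exists T => //.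
have arith s t m : (t + s <= m -> m < 2 * s -> 2 * t <= m)%N by lia.
by rewrite MT (arith _ _ _ TSn xbig).
Qed.

(** With [C = exp (3 t)] and [t > 1], taking logarithms leaves [2 + 6 t < C]. This follows from
    [C >= (1 + t) ^ 3], since the two polynomials agree at [t = 1] and the cubic grows faster beyond
    it. *)
Lemma supercritical_rate (R : realType) (C : R) :
  expR 3 < C -> expR 1 * C * expR (- (C / 2)) < 1.
Proof.
move=> C3; have C0 : 0 < C := lt_trans (expR_gt0 _) C3.
pose t := ln C / 3; have lnC : ln C = 3 * t by rewrite /t; field.
have t1 : 1 < t.
  by rewrite /t ltr_pdivlMr // mul1r -[3]expRK ltr_ln // posrE expR_gt0.
have CE : C = expR t ^+ 3 by rewrite -expRM_natl -lnC lnK.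
have Ct : (1 + t) ^+ 3 <= C.
  by rewrite CE lerXn2r ?nnegrE ?expR_ge0 ?expR_ge1Dx //; lra.
rewrite -{1}(lnK C0) -!expRD -[ltRHS]expR0 ltr_expR lnC.
have : 2 + 6 * t < (1 + t) ^+ 3 by nra.
lra.
Qed.

(** * The two regimes *)

Theorem theorem1 (R : realType) (C : R) (C_gt0 : 0 < C) :
  (expR 3 < C ->
    exists M1 eps1 : R, 0 < M1 /\ 0 < eps1 /\
      exists N : nat, forall n : nat, (N <= n)%N -> (1 <= n)%N -> C <= n%:R ->
        eps1 <= er_prob (C / n%:R) (@event_E R n M1)) /\
  (C < expR (- 1) ->
    exists M2 : R, 0 < M2 /\
      exists N : nat, forall n : nat, (N <= n)%N -> (1 <= n)%N -> C <= n%:R ->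
        1 - 1 / n%:R ^+ 2 <= er_prob (C / n%:R) (@event_F R n M2)).
Proof.
have rate q : 0 < q < 1 -> 0 < - 5 / ln q :> R /\ - 5 / ln q * ln q = - 5.
  by move=> q01; have lq := ln_lt0 q01; rewrite divfK ?ltr0_neq0 // nmulr_lgt0 ?invr_lt0.
split=> [C3|Ce].
- have C8 : 8 <= C.
    apply/ltW; apply: le_lt_trans C3; rewrite -[3]mulr1 expRM_natl.
    have e2 : 2 <= expR 1 :> R by apply: le_trans (expR_ge1Dx 1); lra.
    by apply: (@le_trans _ _ (2 ^+ 3)); [lra|rewrite lerXn2r ?nnegrE ?expR_ge0].
  pose q := expR 1 * C * expR (- (C / 2)).
  have q01 : 0 < q < 1 by rewrite supercritical_rate // !mulr_gt0 ?expR_gt0.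
  have [M0 Mq] := rate q q01; set M := _ / _ in M0 Mq.
  exists M, (1 / 2); split=> //; split; first by lra.
  (* From [n = 7] on, [(4 / 5) ^ n <= 1 / 4]; the other error is at most [1 / 8], so the total stays
     below [1 / 2]. *)
  exists 7%N => n n7 n1 Cn; have n0 : 0 < n%:R :> R by rewrite ltr0n.
  rewrite er_prob_predC.
  pose Q k := (M * ln (n%:R : R) <= k%:R) && (2 * k <= n)%N.
  have DE (w : config n) : predC (event_E M) w ->
      [pred w : config n | [exists S in components w, Q #|S|]] w ||
      [pred w : config n | [exists S : {set 'I_n},
        detached w S && (n <= 4 * #|S| <= 3 * n)%N]] w.
    apply: contraR; rewrite negb_or => /andP[]; exact: event_E_intro.
  have := er_prob_predU (sparse_prob01 n1 C_gt0 Cn) DE.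
  have := er_prob_balanced_detached n1 C_gt0 Cn C8.
  have QM k : Q k -> M * ln n%:R <= k%:R by case/andP.
  have Qq k : Q k -> (0 < k <= n)%N ->
      (expR 1 * C) ^+ k * expR (- (C / n%:R * (k * (n - k))%:R)) <= q ^+ k.
    move=> /andP[_ kn] _; rewrite /q [leRHS]exprMn ler_pM2l ?exprn_gt0 ?mulr_gt0 ?expR_gt0 //.
    rewrite -expRM_natl ler_expR mulrN lerN2 natrM natrB; last by lia.
    (* As [k <= n/2], the factor [(n - k) / n] is at least [1 / 2], which yields the exponent
       [- C / 2] in [q]. *)
    have kn' : 2 * k%:R <= n%:R :> R by rewrite -natrM ler_nat.
    rewrite mulrAC ler_pdivlMr //.
    have : 0 <= C * k%:R * (n%:R - 2 * k%:R) by rewrite !mulr_ge0 ?subr_ge0 ?(ltW C_gt0).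
    nra.
  have := er_prob_component_sizes n1 C_gt0 Cn q01 Mq QM Qq.
  have : (C * n%:R ^+ 3)^-1 <= 8^-1.
    rewrite lef_pV2 ?posrE ?mulr_gt0 ?exprn_gt0 //; apply: le_trans C8 _.
    by rewrite ler_peMr ?(ltW C_gt0) // exprn_ege1 // ler1n.
  have : (4 / 5) ^+ n <= 1 / 4 :> R.
    apply: (@le_trans _ _ ((4 / 5) ^+ 7)); last by lra.
    by rewrite ler_wiXn2l //; lra.
  lra.
- pose q := expR 1 * C.
  have q01 : 0 < q < 1.
    rewrite mulr_gt0 ?expR_gt0 //= -(expRxMexpNx_1 1).
    by rewrite ltr_pM2l ?expR_gt0.
  (* The threshold [Num.bound C^-1] ensures [C * n >= 1], which turns [1 / (C * n ^ 3)] into at most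
     [1 / n ^ 2]. *)
  have [M0 Mq] := rate q q01; set M := _ / _ in M0 Mq.
  exists M; split=> //; exists (Num.bound C^-1) => n nN n1 Cn.
  have n0 : 0 < n%:R :> R by rewrite ltr0n.
  have Vn : C^-1 <= n%:R.
    apply: le_trans (ltW (archi_boundP _)) _; first by rewrite invr_ge0 ltW.
    by rewrite ler_nat.
  rewrite er_prob_predC lerD2l lerN2 div1r.
  pose Q k := M * ln (n%:R : R) <= k%:R.
  have DF (w : config n) : predC (event_F M) w ->
      [pred w : config n | [exists S in components w, Q #|S|]] w.
    rewrite /= negb_forall => /existsP[S]; rewrite negb_imply -leNgt => /andP[Sw QS].
    by apply/exists_inP; exists S.
  apply: le_trans (er_prob_le (sparse_prob01 n1 C_gt0 Cn) DF) _.
  apply: le_trans (er_prob_component_sizes n1 C_gt0 Cn q01 Mq _ _) _ => //.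
    (* The factor from the closed cut edges is bounded by 1: the tree count alone decays when
       [e * C < 1]. *)
    move=> k _ _; rewrite ler_piMr ?exprn_ge0 ?mulr_ge0 ?expR_ge0 ?(ltW C_gt0) //.
    by rewrite -expR0 ler_expR oppr_le0 !mulr_ge0 ?invr_ge0 ?ler0n ?(ltW C_gt0).
  rewrite lef_pV2 ?posrE ?mulr_gt0 ?exprn_gt0 // (exprSr _ 2) mulrCA.
  by rewrite ler_peMr ?exprn_ge0 ?(ltW n0) // -ler_pdivrMl // mulr1.
Qed.
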